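(* Let $H$ be the Hilbert space of (classes of) random variables with finite second moments on a probability space, let $\xi^{(1)}=(\xi^{(1)}_t)_{t\in\mathbb R}$ and $\xi^{(2)}=(\xi^{(2)}_t)_{t\in\mathbb R}$ be processes with stationary increments in $H$ (continuous curves with $\xi^{(1)}_0=\xi^{(2)}_0=0$), and let $U^{(1)}\in\mathcal I(\xi^{(1)})$. There exists a Markovian isometrical operator $R:H^{\xi^{(1)}}\to H^{\xi^{(2)}}$ with $\xi^{(2)}_t=R\xi^{(1)}_t$ for all $t\in\mathbb R$ if and only if there exists a Markovian $U^{(1)}$-cocycle $W=(W_t)_{t\in\mathbb R}$ in $H$ such that $\xi^{(2)}_t=W_t\xi^{(1)}_t$ for $t\le0$ and $\xi^{(2)}_t=\xi^{(1)}_t$ for $t>0$.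
   Context: The inner product in $H$ is $(\xi,\eta)=\mathbb E(\xi\overline\eta)$. For a continuous curve $\xi$ in $H$ with $\xi_0=0$, $\mathcal I(\xi)$ is the set of strongly continuous one-parameter unitary groups $U=(U_t)_{t\in\mathbb R}$ in $H$ with $\xi_{t+s}=\xi_t+U_t\xi_s$ for all $s,t\in\mathbb R$ (i.e. $\xi$ is invariant with respect to $U$). $\xi$ has stationary increments if the inner products $(\xi_{a+t}-\xi_{b+t},\xi_{c+t}-\xi_{d+t})$ do not depend on $t$; equivalently the shift of increments is implemented by a unitary group in the closed span of increments, and (extending this group, e.g. trivially) $\mathcal I(\xi)\neq\emptyset$. $H^\xi$ is the closed linear span of all increments $\xi_s-\xi_r$, and $H^\xi_{[t}$ is the closed span of $\xi_s-\xi_r$ with $s,r\ge t$. A Markovian $U^{(1)}$-cocycle is a strongly continuous family of unitaries $W=(W_t)_{t\in\mathbb R}$ in $H$ with $W_0=I$, $W_{t+s}=W_tU^{(1)}_tW_sU^{(1)*}_t$ for $s,t\in\mathbb R$, and $W_tf=f$ for $f\in H^{\xi^{(1)}}_{[t}$, $t>0$. An isometrical operator $R:H^{\xi^{(1)}}\to H^{\xi^{(2)}}$ is Markovian if $Rf=f$ for all $f\in H^{\xi^{(1)}}_{[0}$. *)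

(* Defs.v *)
From HB Require Import structures.
From mathcomp Require Import all_boot all_order all_algebra.
From mathcomp Require Import complex.
From mathcomp Require Import all_classical all_reals all_analysis.
From mathcomp Require Import measurable_realfun.
From mathcomp Require Import ring lra.

Set Implicit Arguments.
Unset Strict Implicit.
Unset Printing Implicit Defensive.
Import Order.TTheory GRing.Theory Num.Theory.
Import numFieldNormedType.Exports.
Local Open Scope classical_set_scope.
Local Open Scope ring_scope.
Local Open Scope complex_scope.
Local Open Scope quotient_scope.
#[local] Arguments complex.Re {R} _.
#[local] Arguments complex.Im {R} _.

Section SquareIntegrable.
Context {d : measure_display} {T : measurableType d} {R : realType}.
Variable P : probability T R.

(* Only meaningful when the real and imaginary parts of X are integrable. *)
Definition cexpectation (X : T -> R[i]) : R[i] :=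
  fine ('E_P[complex.Re \o X])%E +i* fine ('E_P[complex.Im \o X])%E.

(* A complex random variable is encoded as a function whose real and imaginary
   parts are measurable, R[i] having no sigma-algebra in the library. *)
Definition finite_second_moment (X : T -> R[i]) : Prop :=
  [/\ measurable_fun setT (complex.Re \o X),
      measurable_fun setT (complex.Im \o X) &
      ('E_P[fun w => (Normc.normc (X w) ^+ 2)%R] < +oo)%E].

Lemma Lfun2P (f : T -> R) : measurable_fun setT f ->
  (\int[P]_w ((f w) ^+ 2)%:E < +oo)%E -> f \in Lfun P 2%:E.
Proof.
move=> mf fi; rewrite inE; apply/andP; split; rewrite inE//=.
rewrite /finite_norm unlock poweR_lty//.
under eq_integral => x _ do rewrite /= powR_mulrn// real_normK ?num_real//.
exact: fi.
Qed.

Lemma Lfun2_measurable (f : T -> R) : f \in Lfun P 2%:E -> measurable_fun setT f.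
Proof. by rewrite inE => /andP[/[!inE]]. Qed.

Lemma normc_sqr (z : R[i]) : Normc.normc z ^+ 2 = complex.Re z ^+ 2 + complex.Im z ^+ 2.
Proof. by case: z => a b /=; rewrite sqr_sqrtr// addr_ge0// sqr_ge0. Qed.

Lemma finite_second_momentP (X : T -> R[i]) : finite_second_moment X <->
  complex.Re \o X \in Lfun P 2%:E /\ complex.Im \o X \in Lfun P 2%:E.
Proof.
have E : (fun w => (Normc.normc (X w) ^+ 2)%:E) =
    (fun w => ((complex.Re \o X) w ^+ 2)%:E + ((complex.Im \o X) w ^+ 2)%:E)%E.
  by apply/funext => w; rewrite normc_sqr.
rewrite /finite_second_moment unlock E; split.
  case=> mr mi; rewrite ge0_integralD//; last 4 first.
  - by move=> w _; rewrite lee_fin sqr_ge0.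
  - by apply/measurable_EFinP; exact: measurable_funX.
  - by move=> w _; rewrite lee_fin sqr_ge0.
  - by apply/measurable_EFinP; exact: measurable_funX.
  have p f : (0 <= \int[P]_w ((f w : R) ^+ 2)%:E)%E.
    by apply: integral_ge0 => w _; rewrite lee_fin sqr_ge0.
  move=> h; split; apply: Lfun2P => //; apply: le_lt_trans h.
    by rewrite leeDl.
  by rewrite leeDr.
move=> [hr hi]; split; [exact: Lfun2_measurable..|].
apply: integrable_lty => //.
by apply: integrableD => //; exact: Lfun2_integrable_sqr.
Qed.

(* (R[i])^o selects the left module structure of R[i] over itself, R[i] being
   also declared as a left module over R. *)
Definition L2pred : {pred T -> (R[i])^o} :=
  [pred X | `[< finite_second_moment X >]].

Lemma L2predP (X : T -> R[i]) : reflect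
  (complex.Re \o X \in Lfun P 2%:E /\ complex.Im \o X \in Lfun P 2%:E)
  (X \in L2pred).
Proof.
rewrite inE; apply: (iffP (asboolP _)) => h; exact/finite_second_momentP.
Qed.

Lemma L2pred_submod : submod_closed L2pred.
Proof.
have l1 : (1 <= 2 :> R) by rewrite ler1n.
split=> [|a X Y /L2predP[Xr Xi] /L2predP[Yr Yi]].
  by apply/L2predP; split; exact: (@rpred0 _ (Lfun P 2%:E)).
apply/L2predP; split.
- have -> : complex.Re \o (a *: X + Y) =
      (complex.Re a *: (complex.Re \o X) - complex.Im a *: (complex.Im \o X))
      + (complex.Re \o Y).
    by apply/funext => w /=; rewrite !fctE/=; case: a (X w) (Y w) => ? ? [? ?] [? ?].
  by apply: rpredD => //; apply: rpredB; apply: rpredZ.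
- have -> : complex.Im \o (a *: X + Y) =
      (complex.Re a *: (complex.Im \o X) + complex.Im a *: (complex.Re \o X))
      + (complex.Im \o Y).
    by apply/funext => w /=; rewrite !fctE/=; case: a (X w) (Y w) => ? ? [? ?] [? ?].
  by apply: rpredD => //; apply: rpredD; apply: rpredZ.
Qed.

HB.instance Definition _ := GRing.isSubmodClosed.Build _ _ L2pred L2pred_submod.

Definition L2fun : Type := {X : T -> (R[i])^o | X \in L2pred}.
HB.instance Definition _ := SubChoice.on L2fun.
HB.instance Definition _ := [SubChoice_isSubLmodule of L2fun by <:].

Lemma ReL2 (X : L2fun) : complex.Re \o val X \in Lfun P 2%:E.
Proof. by case/L2predP: (valP X). Qed.

Lemma ImL2 (X : L2fun) : complex.Im \o val X \in Lfun P 2%:E.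
Proof. by case/L2predP: (valP X). Qed.

Definition L2fun_eq (X Y : L2fun) : bool :=
  `[< {ae P, forall w, val X w = val Y w} >].

Lemma L2fun_eq_refl : reflexive L2fun_eq.
Proof. by move=> X; apply/asboolP; apply: nearW. Qed.

Lemma L2fun_eq_sym : symmetric L2fun_eq.
Proof.
by move=> X Y; apply/asboolP/asboolP; apply: filterS => w ->.
Qed.

Lemma L2fun_eq_trans : transitive L2fun_eq.
Proof.
move=> Y X Z /asboolP XY /asboolP YZ; apply/asboolP.
by apply: filterS2 XY YZ => w -> ->.
Qed.

Canonical L2fun_equiv :=
  EquivRel L2fun_eq L2fun_eq_refl L2fun_eq_sym L2fun_eq_trans.

Definition L2 : Type := {eq_quot L2fun_eq}.
HB.instance Definition _ := Choice.on L2.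
HB.instance Definition _ := EqQuotient.on L2.

Lemma L2_eqP (X Y : L2fun) :
  reflect {ae P, forall w, val X w = val Y w} (\pi_L2 X == \pi_L2 Y).
Proof. by rewrite eqmodE; exact: asboolP. Qed.

Lemma reprL2_ae (X : L2fun) : {ae P, forall w, val (repr (\pi_L2 X)) w = val X w}.
Proof. by apply/L2_eqP; rewrite reprK. Qed.

Lemma L2_ind (Q : L2 -> Prop) : (forall X, Q (\pi_L2 X)) -> forall f, Q f.
Proof. by move=> QX f; rewrite -[f]reprK; exact: QX. Qed.

Definition L2zero : L2 := \pi_L2 0.
Definition L2opp (f : L2) : L2 := \pi_L2 (- repr f).
Definition L2add (f g : L2) : L2 := \pi_L2 (repr f + repr g).
Definition L2scale (a : R[i]) (f : L2) : L2 := \pi_L2 (a *: repr f).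

Lemma L2valN (X : L2fun) w : val (- X) w = - val X w. Proof. by []. Qed.

Lemma L2valD (X Y : L2fun) w : val (X + Y) w = val X w + val Y w. Proof. by []. Qed.

Lemma L2valZ a (X : L2fun) w : val (a *: X) w = a * val X w. Proof. by []. Qed.

Lemma L2oppE X : L2opp (\pi_L2 X) = \pi_L2 (- X).
Proof. by apply/eqP/L2_eqP; apply: filterS (reprL2_ae X) => w h; rewrite !L2valN h. Qed.

Lemma L2addE X Y : L2add (\pi_L2 X) (\pi_L2 Y) = \pi_L2 (X + Y).
Proof.
apply/eqP/L2_eqP; apply: filterS2 (reprL2_ae X) (reprL2_ae Y) => w h k.
by rewrite !L2valD h k.
Qed.

Lemma L2scaleE a X : L2scale a (\pi_L2 X) = \pi_L2 (a *: X).
Proof. by apply/eqP/L2_eqP; apply: filterS (reprL2_ae X) => w h; rewrite !L2valZ h. Qed.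

Lemma L2addA : associative L2add.
Proof.
by elim/L2_ind=> X; elim/L2_ind=> Y; elim/L2_ind=> Z; rewrite !L2addE addrA.
Qed.

Lemma L2addC : commutative L2add.
Proof. by elim/L2_ind=> X; elim/L2_ind=> Y; rewrite !L2addE addrC. Qed.

Lemma L2add0f : left_id L2zero L2add.
Proof. by elim/L2_ind=> X; rewrite L2addE add0r. Qed.

Lemma L2addNf : left_inverse L2zero L2opp L2add.
Proof. by elim/L2_ind=> X; rewrite L2oppE L2addE addNr. Qed.

HB.instance Definition _ := GRing.isZmodule.Build L2 L2addA L2addC L2add0f L2addNf.

Lemma L2scaleA a b f : L2scale a (L2scale b f) = L2scale (a * b) f.
Proof. by elim/L2_ind: f => X; rewrite !L2scaleE scalerA. Qed.

Lemma L2scale1 : left_id 1 L2scale.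
Proof. by elim/L2_ind => X; rewrite !L2scaleE scale1r. Qed.

Lemma L2scaleDr : right_distributive L2scale +%R.
Proof.
move=> a; elim/L2_ind=> X; elim/L2_ind=> Y.
by rewrite /GRing.add/= !(L2addE, L2scaleE) scalerDr.
Qed.

Lemma L2scaleDl f : {morph L2scale^~ f : a b / a + b}.
Proof.
by elim/L2_ind: f => X a b; rewrite [in RHS]/GRing.add/= !(L2addE, L2scaleE) scalerDl.
Qed.

HB.instance Definition _ :=
  GRing.Zmodule_isLmodule.Build R[i] L2 L2scaleA L2scale1 L2scaleDr L2scaleDl.

Lemma L2_pi_linear : linear (\pi_L2 : L2fun -> L2).
Proof. by move=> a X Y; rewrite /GRing.add/= /GRing.scale/= !(L2addE, L2scaleE). Qed.

Definition cL1 (X : T -> R[i]) :=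
  complex.Re \o X \in Lfun P 1%E /\ complex.Im \o X \in Lfun P 1%E.

Lemma cexpectationD X Y : cL1 X -> cL1 Y ->
  cexpectation (fun w => X w + Y w) = cexpectation X + cexpectation Y.
Proof.
case=> Xr Xi [Yr Yi]; rewrite /cexpectation.
have -> : complex.Re \o (fun w => X w + Y w) = (complex.Re \o X) \+ (complex.Re \o Y).
  by apply/funext => w /=; case: (X w) (Y w) => ? ? [].
have -> : complex.Im \o (fun w => X w + Y w) = (complex.Im \o X) \+ (complex.Im \o Y).
  by apply/funext => w /=; case: (X w) (Y w) => ? ? [].
by rewrite !expectationD// !fineD// expectation_fin_num.
Qed.

Lemma cexpectationZ a X : cL1 X ->
  cexpectation (fun w => a * X w) = a * cexpectation X.
Proof.
case=> Xr Xi; rewrite /cexpectation; case: a => a b.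
have -> : complex.Re \o (fun w => (a +i* b) * X w) =
    (a \o* (complex.Re \o X)) \+ (- b \o* (complex.Im \o X)).
  by apply/funext => w /=; case: (X w) => ? ? /=; rewrite /=; ring.
have -> : complex.Im \o (fun w => (a +i* b) * X w) =
    (a \o* (complex.Im \o X)) \+ (b \o* (complex.Re \o X)).
  by apply/funext => w /=; case: (X w) => ? ? /=; rewrite /=; ring.
rewrite !expectationD ?Lfun_scale// !expectationZl// !fineD ?fin_numM ?expectation_fin_num//.
rewrite !fineM ?expectation_fin_num//=.
by apply/eqP; rewrite eq_complex /=; apply/andP; split; apply/eqP; ring.
Qed.

Lemma cexpectationJ X : cL1 X -> cexpectation (fun w => (X w)^*) = (cexpectation X)^*.
Proof.
case=> Xr Xi; rewrite /cexpectation /=.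
have -> : complex.Re \o (fun w => (X w)^*) = complex.Re \o X.
  by apply/funext => w /=; case: (X w).
have -> : complex.Im \o (fun w => (X w)^*) = -1 \o* (complex.Im \o X).
  by apply/funext => w /=; case: (X w) => ? ? /=; rewrite mulrN1.
by rewrite expectationZl// EFinN mulN1e fineN.
Qed.

Lemma L2mul (X Y : L2fun) : cL1 (fun w => val X w * (val Y w)^*).
Proof.
split.
- have -> : complex.Re \o (fun w => val X w * (val Y w)^*) =
      (complex.Re \o val X) \* (complex.Re \o val Y)
      + (complex.Im \o val X) \* (complex.Im \o val Y).
    apply/funext => w /=; rewrite !fctE /=.
    by case: (\val X w) (\val Y w) => ? ? [? ?] /=; ring.
  by apply: rpredD; apply: Lfun2_mul_Lfun1; (exact: ReL2 || exact: ImL2).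
- have -> : complex.Im \o (fun w => val X w * (val Y w)^*) =
      (complex.Im \o val X) \* (complex.Re \o val Y)
      - (complex.Re \o val X) \* (complex.Im \o val Y).
    apply/funext => w /=; rewrite !fctE /=.
    by case: (\val X w) (\val Y w) => ? ? [? ?] /=; ring.
  by apply: rpredB; apply: Lfun2_mul_Lfun1; (exact: ReL2 || exact: ImL2).
Qed.

Lemma cexpectation_ae X Y : cL1 X -> cL1 Y -> {ae P, forall w, X w = Y w} ->
  cexpectation X = cexpectation Y.
Proof.
move=> [Xr Xi] [Yr Yi] XY; rewrite /cexpectation unlock.
have m f : f \in Lfun P 1%E -> measurable_fun setT (EFin \o f).
  by rewrite inE => /andP[/[!inE] mf _]; exact/measurable_EFinP.
congr (fine _ +i* fine _); apply: ae_eq_integral => //; try exact: m.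
- by apply: filterS XY => w /= ->.
- by apply: filterS XY => w /= ->.
Qed.

Definition inner (f g : L2) : R[i] :=
  cexpectation (fun w => val (repr f) w * (val (repr g) w)^*).

Lemma inner_pi X Y :
  inner (\pi_L2 X) (\pi_L2 Y) = cexpectation (fun w => val X w * (val Y w)^*).
Proof.
apply: cexpectation_ae; [exact: L2mul..|].
by apply: filterS2 (reprL2_ae X) (reprL2_ae Y) => w -> ->.
Qed.

Lemma inner_linearl g : scalar (inner^~ g).
Proof.
elim/L2_ind: g => Z a; elim/L2_ind=> X; elim/L2_ind=> Y.
rewrite -L2_pi_linear !inner_pi -cexpectationZ; last exact: L2mul.
have aXZ : (fun w => a * (val X w * (val Z w)^*)) =
    (fun w => val (a *: X) w * (val Z w)^*).
  by apply/funext => w; rewrite L2valZ mulrA.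
rewrite aXZ -cexpectationD; [|exact: L2mul|exact: L2mul].
by congr cexpectation; apply/funext => w; rewrite L2valD mulrDl.
Qed.

Lemma innerC f g : inner g f = (inner f g)^*.
Proof.
rewrite -cexpectationJ; last exact: L2mul.
congr cexpectation; apply/funext => w.
by rewrite rmorphM /= conjcK mulrC.
Qed.

Lemma inner_pi_norm X : inner (\pi_L2 X) (\pi_L2 X) =
  (fine ('E_P[fun w => (Normc.normc (val X w) ^+ 2)%R])%E)%:C.
Proof.
rewrite inner_pi /cexpectation.
have -> : complex.Re \o (fun w => val X w * (val X w)^*) =
    (fun w => Normc.normc (val X w) ^+ 2).
  by apply/funext => w; rewrite normc_sqr /=; case: (\val X w) => a b /=; ring.
have -> : complex.Im \o (fun w => val X w * (val X w)^*) = cst 0.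
  by apply/funext => w /=; case: (\val X w) => a b /=; ring.
by rewrite expectation_cst.
Qed.

Lemma inner_ge0 f : 0 <= inner f f.
Proof.
elim/L2_ind: f => X; rewrite inner_pi_norm ler0c fine_ge0//.
by apply: expectation_ge0 => w; rewrite sqr_ge0.
Qed.

Lemma inner_eq0 f : inner f f = 0 -> f = 0.
Proof.
elim/L2_ind: f => X; rewrite inner_pi_norm => /(congr1 (complex.Re)) /= E0.
have [mr mi fi] : finite_second_moment (val X) by apply/asboolP; have := valP X; rewrite inE.
have {fi}E0 : ('E_P[fun w => (Normc.normc (val X w) ^+ 2)%R] = 0)%E.
  rewrite -[LHS]fineK ?E0// ge0_fin_numE//.
  by apply: expectation_ge0 => w; rewrite sqr_ge0.
apply/eqP/L2_eqP.
have mX : measurable_fun setT (fun w => Normc.normc (val X w) ^+ 2).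
  under eq_fun do rewrite normc_sqr.
  by apply: measurable_funD; apply: measurable_funX.
move: E0; rewrite unlock => E0.
have : (\int[P]_w `|(Normc.normc (val X w) ^+ 2)%:E|)%E = 0%E.
  by rewrite -[RHS]E0; apply: eq_integral => w _; rewrite gee0_abs// lee_fin sqr_ge0.
move/(ae_eq_integral_abs _ measurableT) => /= h.
have /h : measurable_fun setT (EFin \o (fun w => Normc.normc (val X w) ^+ 2)).
  exact/measurable_EFinP.
apply: filterS => w /(_ I) [] /eqP; rewrite sqrf_eq0 => /eqP /Normc.eq0_normc ->.
by [].
Qed.

(* The norm of a normed module over R[i] is R[i]-valued. *)
Definition L2norm (f : L2) : R[i] := (Num.sqrt (complex.Re (inner f f)))%:C.

Definition reinner f g : R := complex.Re (inner f g).

Lemma innerDl f g h : inner (f + g) h = inner f h + inner g h.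
Proof. by have := inner_linearl h 1 f g; rewrite scale1r mul1r. Qed.

Lemma innerZl a f h : inner (a *: f) h = a * inner f h.
Proof.
have inner0l : inner 0 h = 0.
  by have := inner_linearl h 1 0 0; rewrite scale1r addr0 mul1r => /eqP;
    rewrite -subr_eq0 opprD addNKr oppr_eq0 => /eqP.
by have := inner_linearl h a f 0; rewrite !addr0 inner0l addr0.
Qed.

Lemma reinnerC f g : reinner g f = reinner f g.
Proof. by rewrite /reinner innerC; case: (inner f g). Qed.

Lemma reinnerDl f g h : reinner (f + g) h = reinner f h + reinner g h.
Proof. by rewrite /reinner innerDl; case: (inner f h) (inner g h) => ? ? []. Qed.

Lemma reinnerZl (a : R) f h : reinner (a%:C *: f) h = a * reinner f h.
Proof. by rewrite /reinner innerZl; case: (inner f h) => ? ? /=; ring. Qed.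

Lemma reinnerDr f g h : reinner f (g + h) = reinner f g + reinner f h.
Proof. by rewrite !(reinnerC _ f) -reinnerDl reinnerC. Qed.

Lemma reinnerZr (a : R) f g : reinner f (a%:C *: g) = a * reinner f g.
Proof. by rewrite reinnerC reinnerZl reinnerC. Qed.

Lemma reinner_ge0 f : 0 <= reinner f f.
Proof. by have := inner_ge0 f; rewrite lecE => /andP[]. Qed.

#[local] Hint Resolve reinner_ge0 : core.

Lemma inner_selfE f : inner f f = (reinner f f)%:C.
Proof. by rewrite /reinner RRe_real// ger0_real// inner_ge0. Qed.

Lemma reinner_CS f g :
  reinner f g <= Num.sqrt (reinner f f) * Num.sqrt (reinner g g).
Proof.
set a := Num.sqrt _; set b := Num.sqrt _.
have a2 : reinner f f = a ^+ 2 by rewrite sqr_sqrtr.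
have b2 : reinner g g = b ^+ 2 by rewrite sqr_sqrtr.
have [f0|fN0] := eqVneq f 0.
  by rewrite f0 /reinner -(scale0r f) innerZl mul0r mulr_ge0// sqrtr_ge0.
have [g0|gN0] := eqVneq g 0.
  by rewrite g0 reinnerC /reinner -(scale0r g) innerZl mul0r mulr_ge0// sqrtr_ge0.
have pos h : h != 0 -> 0 < Num.sqrt (reinner h h).
  move=> hN0; rewrite sqrtr_gt0 lt_neqAle reinner_ge0 andbT eq_sym.
  by apply: contra hN0 => /eqP e; apply/eqP/inner_eq0; rewrite inner_selfE e.
have a0 : 0 < a by exact: pos.
have b0 : 0 < b by exact: pos.
have := reinner_ge0 (b%:C *: f + (- a)%:C *: g).
rewrite !(reinnerDl, reinnerDr, reinnerZl, reinnerZr).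
rewrite (reinnerC f g) a2 b2 => h.
have {h} : 0 <= (2 * a * b) * (a * b - reinner f g).
  by rewrite (le_trans h)// le_eqVlt; apply/orP; left; apply/eqP; ring.
by rewrite pmulr_rge0 ?subr_ge0// !mulr_gt0.
Qed.

Lemma L2normE f : L2norm f = (Num.sqrt (reinner f f))%:C. Proof. by []. Qed.

Lemma ler_L2normD f g : L2norm (f + g) <= L2norm f + L2norm g.
Proof.
rewrite !L2normE -(rmorphD (real_complex R)) lecR.
rewrite -ler_sqr ?nnegrE ?addr_ge0 ?sqrtr_ge0// sqr_sqrtr//.
rewrite !(reinnerDl, reinnerDr) (reinnerC f g).
rewrite sqrrD !sqr_sqrtr//; have := reinner_CS f g; lra.
Qed.

Lemma L2normZ (a : R[i]) f : L2norm (a *: f) = `|a| * L2norm f.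
Proof.
have e : inner (a *: f) (a *: f) = `|a| ^+ 2 * inner f f.
  by rewrite innerZl innerC innerZl (rmorphM (@conjc R)) -[X in _ * (_ * X)]innerC mulrA sqr_normc.
have na : `|a| = (Normc.normc a)%:C by [].
have na0 : 0 <= Normc.normc a by rewrite -ler0c -na.
rewrite !L2normE na -(rmorphM (real_complex R)); congr (_%:C).
rewrite /reinner e inner_selfE na -(rmorphXn (real_complex R)).
by rewrite -(rmorphM (real_complex R)) [complex.Re _]/= sqrtrM ?sqr_ge0// sqrtr_sqr ger0_norm.
Qed.

Lemma L2norm_eq0 f : L2norm f = 0 -> f = 0.
Proof.
move=> /complexI /eqP; rewrite sqrtr_eq0 => h; apply: inner_eq0.
by rewrite inner_selfE; congr (_%:C); apply/le_anti; rewrite h reinner_ge0.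
Qed.

HB.instance Definition _ :=
  Lmodule_isNormed.Build R[i] L2 ler_L2normD L2normZ L2norm_eq0.

Lemma L2_normE (f : L2) : `|f| = (Num.sqrt (complex.Re (inner f f)))%:C.
Proof. by []. Qed.

End SquareIntegrable.

Section Operators.
Context {d : measure_display} {T : measurableType d} {R : realType}.
Variable P : probability T R.
Local Notation H := (L2 P).
Implicit Types (A B : set H) (V W : H -> H) (U : R -> H -> H) (xi : R -> H).

Definition linear_span A : set H :=
  [set f | exists (n : nat) (a : 'I_n -> R[i]) (g : 'I_n -> H),
    (forall i, A (g i)) /\ f = \sum_(i < n) a i *: g i].

Definition closed_span A : set H := closure (linear_span A).

Definition increments xi (D : set R) : set H :=
  [set f | exists s r, [/\ D s, D r & f = xi s - xi r]].

Definition Hspace xi : set H := closed_span (increments xi setT).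

Definition Hfuture xi (t : R) : set H :=
  closed_span (increments xi [set s | t <= s]).

Definition stationary_increments xi : Prop :=
  forall a b c e t t' : R,
    inner (xi (a + t) - xi (b + t)) (xi (c + t) - xi (e + t)) =
    inner (xi (a + t') - xi (b + t')) (xi (c + t') - xi (e + t')).

Definition stationary_process xi : Prop :=
  [/\ continuous xi, xi 0 = 0 & stationary_increments xi].

Definition unitary V : Prop :=
  [/\ linear V, forall f g, inner (V f) (V g) = inner f g &
      forall g, exists f, V f = g].

(* adjoint V g is the vector h with (V f, g) = (f, h) for all f, and 0 if there
   is none; see inner_adjoint for unitary V. *)
Definition adjoint V : H -> H :=
  fun g => xget 0 [set h | forall f, inner (V f) g = inner f h].

Lemma inner_adjoint V f g : unitary V -> inner (V f) g = inner f (adjoint V g).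
Proof.
case=> _ Vi Vs; rewrite /adjoint; case: xgetP => [h _ ->//|] none.
by have [h hg] := Vs g; case: (none h) => k /=; rewrite -hg Vi.
Qed.

Lemma adjointK V f : unitary V -> adjoint V (V f) = f.
Proof.
move=> uV; have [_ Vi _] := uV.
have e h : inner h (adjoint V (V f)) = inner h f.
  by rewrite -inner_adjoint// Vi.
apply/eqP; rewrite -subr_eq0; apply/eqP/inner_eq0.
set x := adjoint V (V f) - f; rewrite [in X in inner _ X]/x.
by rewrite innerC innerDl -scaleN1r innerZl mulN1r !(innerC x) e subrr conjc0.
Qed.

Definition strongly_continuous U : Prop := forall f, continuous (U^~ f).

Definition unitary_group U : Prop :=
  [/\ forall t, unitary (U t), forall f, U 0 f = f,
      forall t s f, U (t + s) f = U t (U s f) & strongly_continuous U].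

Definition invariance_groups xi : set (R -> H -> H) :=
  [set U | unitary_group U /\ forall t s, xi (t + s) = xi t + U t (xi s)].

Definition markovian_cocycle U xi (W : R -> H -> H) : Prop :=
  [/\ (forall t, unitary (W t)) /\ strongly_continuous W,
      forall f, W 0 f = f,
      forall t s f, W (t + s) f = W t (U t (W s (adjoint (U t) f))) &
      forall t f, 0 < t -> Hfuture xi t f -> W t f = f].

(* An operator with domain A is represented by a function on the whole space;
   its values outside A are unconstrained. *)
Definition isometrical_operator A B V : Prop :=
  [/\ forall f, A f -> B (V f),
      forall a f g, A f -> A g -> V (a *: f + g) = a *: V f + V g &
      forall f, A f -> `|V f| = `|f|].

Definition markovian_isometrical_operator xi1 xi2 V : Prop :=
  isometrical_operator (Hspace xi1) (Hspace xi2) V /\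
  forall f, Hfuture xi1 0 f -> V f = f.

End Operators.

(* Main.v *)
(* If U2 is a group for xi2, then W t = U2 t (U1 t)^* is a cocycle with the
   required properties.  Such a U2 exists as soon as an isometry V carries xi1
   to xi2: L2 being complete, the range of V is closed, so U1 can be transported
   to it by V and extended by the identity on the orthogonal complement.
   Conversely, the cocycle identity and the Markov property give
   W t (xi1 s) = xi2 s for all t < 0 and s >= t; hence W (- n) stabilises on
   each increment of xi1, and V is its strong limit on the closed span. *)
Require Import Defs.
From mathcomp Require Import all_boot all_order all_algebra.
From mathcomp Require Import complex.
From mathcomp Require Import all_classical all_reals all_analysis.
From mathcomp Require Import measurable_realfun.
From mathcomp Require Import ring lra.

Set Implicit Arguments.
Unset Strict Implicit.
Unset Printing Implicit Defensive.
Import Order.TTheory GRing.Theory Num.Theory.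
Import numFieldNormedType.Exports.
Local Open Scope classical_set_scope.
Local Open Scope ring_scope.

(** * Completeness of L2 *)

(** A cocycle consists of unitaries of all of [H], while an isometry is given only on [Hspace xi1]
    and is unconstrained elsewhere; hence linearity and norm preservation are stated relative to a
    set, and the group transported to the range has to be extended. The product [U2 t (U1 t)^*] is
    Markovian because [U1 (- t)] moves increments after [t] to nonnegative times, where [xi1] and
    [xi2] agree, and [U2 t] moves them back. In the converse direction every [W (- n)] is onto, but
    a strong limit of unitaries is in general only an isometry. Completeness of [L2] serves both
    directions: it yields the orthogonal projection in one and the strong limit in the other. *)

Section RieszFischerReal.
Context {d : measure_display} {T : measurableType d} {R : realType}.
Variable P : probability T R.

(** Integrate the pointwise inequality |f| <= f^2 / (2e) + e / 2, that is (|f| - e)^2 >= 0; the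
    total mass is 1, so the two halves add up to [e]. *)
Lemma integral_norm_le (f : T -> R) (e : R) : 0 < e -> measurable_fun setT f ->
  (\int[P]_w ((f w) ^+ 2)%:E <= (e ^+ 2)%:E)%E -> (\int[P]_w `|f w|%:E <= e%:E)%E.
Proof.
move=> e0 mf fe.
have m2 : measurable_fun setT (fun w => ((f w) ^+ 2)%:E).
  by apply/measurable_EFinP; exact: measurable_funX.
apply: (@le_trans _ _ (\int[P]_w ((e^-1 / 2)%:E * ((f w) ^+ 2)%:E + (e / 2)%:E))%E).
  apply: ge0_le_integral; rewrite ?measurableT//.
  - by apply/measurable_EFinP; exact: measurableT_comp.
  - by apply: emeasurable_funD => //; exact: measurable_funeM.
  - move=> w _; rewrite lee_fin -(ler_pM2l (mulr_gt0 (ltr0n R 2) e0)).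
    have -> : 2 * e * (e^-1 / 2 * f w ^+ 2 + e / 2) = `|f w| ^+ 2 + e ^+ 2.
      by rewrite real_normK ?num_real//; field; exact: lt0r_neq0.
    rewrite -subr_ge0.
    have -> : `|f w| ^+ 2 + e ^+ 2 - 2 * e * `|f w| = (`|f w| - e) ^+ 2 by ring.
    exact: sqr_ge0.
rewrite ge0_integralD//=; last 3 first.
- by move=> w _; rewrite lee_fin mulr_ge0 ?sqr_ge0// mulr_ge0 ?invr_ge0 ?ltW.
- exact: measurable_funeM.
- by move=> w _; rewrite lee_fin mulr_ge0 ?ltW.
rewrite ge0_integralZl//=; last 2 first.
- by move=> w _; rewrite lee_fin sqr_ge0.
- by rewrite lee_fin mulr_ge0 ?invr_ge0 ?ltW.
rewrite integral_cst//= probability_setT mule1.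
apply: (@le_trans _ _ ((e^-1 / 2)%:E * (e ^+ 2)%:E + (e / 2)%:E)%E).
  rewrite leeD2r// lee_pmul2l// lte_fin divr_gt0// invr_gt0//.
rewrite -EFinM -EFinD lee_fin.
have -> : e^-1 / 2 * e ^+ 2 + e / 2 = e by field; exact: lt0r_neq0.
by [].
Qed.

(** The geometric rate makes the L1 norms of successive differences summable, so the telescoping
    series converges absolutely almost everywhere. Fatou's lemma then carries the quadratic bounds
    over to the limit. *)
Lemma riesz_fischer_real (f : nat -> T -> R) :
  (forall n, f n \in Lfun P 2%:E) ->
  (forall n m, (n <= m)%N ->
    (\int[P]_w ((f m w - f n w) ^+ 2)%:E <= ((1 / (2 ^ n.+1)%:R) ^+ 2)%:E)%E) ->
  exists g : T -> R, g \in Lfun P 2%:E /\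
    forall n, (\int[P]_w ((g w - f n w) ^+ 2)%:E <= ((1 / (2 ^ n.+1)%:R) ^+ 2)%:E)%E.
Proof.
move=> fL fC; have mf n := Lfun2_measurable (fL n).
have e0 n : 0 < 1 / (2 ^ n.+1)%:R :> R by rewrite divr_gt0// ltr0n expn_gt0.
pose D n w : R := `|f n.+1 w - f n w|.
have mD n : measurable_fun setT (fun w => (D n w)%:E).
  by apply/measurable_EFinP/measurableT_comp => //; exact: measurable_funB.
have Dint : (\int[P]_w (\sum_(n <oo) (D n w)%:E) < +oo)%E.
  rewrite integral_nneseries//; last by move=> n w _; rewrite lee_fin /D.
  apply: (@le_lt_trans _ _ (\sum_(0 <= n <oo) ((1 / (2 ^ (n + 1))%:R)%:E : \bar R))%E).
    apply: lee_nneseries => [n _ _|n _].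
      by apply: integral_ge0 => w _; rewrite lee_fin /D.
    by rewrite addn1; apply: integral_norm_le; [|exact: measurable_funB|exact: fC].
  have /cvg_lim := @cvg_geometric_eseries_half R 1 0.
  by rewrite /eseries/= => -> //; rewrite ltry.
have cvgf : {ae P, forall w, cvgn (f ^~ w)}.
  have : P.-integrable setT (fun w => \sum_(n <oo) (D n w)%:E)%E.
    apply/integrableP; split.
      by apply: ge0_emeasurable_sum => // n w _ _; rewrite lee_fin /D.
    have -> // : (\int[P]_w `|\sum_(n <oo) (D n w)%:E| =
      \int[P]_w (\sum_(n <oo) (D n w)%:E))%E.
    apply: eq_integral => w _; rewrite gee0_abs// nneseries_ge0// => n _ _.
    by rewrite lee_fin /D.
  move=> /(integrable_ae measurableT); apply: filterS => w /(_ I) fin.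
  have /normed_cvg : cvgn [normed series (telescope (f ^~ w))].
    apply: nondecreasing_is_cvgn.
      by apply/nondecreasing_seqP => n; rewrite /= seriesSr lerDl normr_ge0.
    pose M := fine (\sum_(n <oo) (D n w)%:E)%E.
    suff : ubound (range [normed series (telescope (f ^~ w))]) M by exists M.
    move=> _ [n _ <-].
    rewrite -lee_fin fineK//= seriesEnat/= -sumEFin.
    by apply: nneseries_lim_ge => k _ _; rewrite lee_fin /D.
  rewrite telescopeK => cf.
  have -> : f ^~ w = (fun n => (f n w - f 0%N w) + f 0%N w).
    by apply/funext => n; rewrite subrK.
  by apply: is_cvgD => //; exact: is_cvg_cst.
(* The upper limit exists and is measurable everywhere; it is the limit wherever the sequence
   converges, and its values on the remaining null set do not matter. *)
pose g w := fine (limn_esup (fun n => (f n w)%:E)).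
have mg : measurable_fun setT g.
  apply: measurableT_comp; first exact: fine_measurable.
  by apply: measurable_fun_limn_esup => n; exact/measurable_EFinP.
have cvgg : {ae P, forall w, f ^~ w @ \oo --> g w}.
  apply: filterS cvgf => w /cvg_ex[l fl]; rewrite /g.
  have /cvg_limn_einf_sup[_ ->] : (fun n => (f n w)%:E) @ \oo --> l%:E.
    by apply: cvg_EFin => //; exact: nearW.
  exact: fl.
have gC n : (\int[P]_w ((g w - f n w) ^+ 2)%:E <= ((1 / (2 ^ n.+1)%:R) ^+ 2)%:E)%E.
  pose h m w := ((f m w - f n w) ^+ 2)%:E.
  have mh m : measurable_fun setT (h m).
    by apply/measurable_EFinP/measurable_funX; exact: measurable_funB.
  have h0 m w : setT w -> (0 <= h m w)%E by move=> _; rewrite lee_fin sqr_ge0.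
  have := fatou P measurableT mh h0.
  have mlim : measurable_fun setT (fun w => limn_einf (h ^~ w)).
    apply: measurableT_comp => //.
    by apply: measurable_fun_limn_esup => m; exact: measurableT_comp.
  have -> : (\int[P]_w limn_einf (h ^~ w) = \int[P]_w ((g w - f n w) ^+ 2)%:E)%E.
    apply: ae_eq_integral => //.
      by apply/measurable_EFinP/measurable_funX; exact: measurable_funB.
    apply: filterS cvgg => w fg _.
    have /cvg_limn_einf_sup[-> //] : h ^~ w @ \oo --> ((g w - f n w) ^+ 2)%:E.
    apply: cvg_EFin; first exact: nearW.
    rewrite expr2 (_ : fine \o _ = (fun m => (f m w - f n w) * (f m w - f n w)))//.
    by apply: cvgM; apply: cvgB => //; exact: cvg_cst.
  (* The lower limit of the integrals is at most their supremum over indices [m >= n], where [fC]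
     applies. *)
  move=> /le_trans; apply; apply: le_trans (limn_einf_sup _) _.
  rewrite /limn_esup /limf_esup; apply: le_trans (ereal_inf_lbound _) _.
    by exists [set m | (n <= m)%N] => //; exists n.
  by apply: ge_ereal_sup => _ [m /= nm <-]; exact: fC.
exists g; split => //.
have l1 : (1 <= 2 :> R) by rewrite ler1n.
have -> : g = (g - f 0%N) + f 0%N by rewrite subrK.
apply: rpredD => //; apply: Lfun2P; first exact: measurable_funB.
by apply: le_lt_trans (gC 0%N) _; rewrite ltry.
Qed.
End RieszFischerReal.

Section Completeness.
Context {d : measure_display} {T : measurableType d} {R : realType}.
Variable P : probability T R.
Local Notation H := (L2 P).
Implicit Types f g h : H.
Local Open Scope complex_scope.
Local Open Scope quotient_scope.
#[local] Arguments complex.Re {R} _.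
#[local] Arguments complex.Im {R} _.

(** The norm of [H] takes values in [R[i]]; this copy in [R] has a total order and can be handled by
    [lra]. *)
Definition rnorm f : R := Num.sqrt (reinner f f).

Lemma normE f : `|f| = (rnorm f)%:C. Proof. by []. Qed.

Lemma rnorm_sqr f : rnorm f ^+ 2 = reinner f f.
Proof. by rewrite sqr_sqrtr// reinner_ge0. Qed.

Lemma rnorm_ge0 f : 0 <= rnorm f. Proof. exact: sqrtr_ge0. Qed.

Lemma rnorm_inj f g : `|f| = `|g| -> rnorm f = rnorm g.
Proof. by rewrite !normE => /complexI. Qed.

Lemma rnormN f : rnorm (- f) = rnorm f.
Proof. by apply: rnorm_inj; rewrite normrN. Qed.

Lemma rnormD f g : rnorm (f + g) <= rnorm f + rnorm g.
Proof. by have := ler_normD f g; rewrite !normE -rmorphD lecR. Qed.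

Lemma rnormBC f g : rnorm (f - g) = rnorm (g - f).
Proof. by rewrite -rnormN opprB. Qed.

Lemma rnormB_trans g f h : rnorm (f - h) <= rnorm (f - g) + rnorm (g - h).
Proof. by apply: le_trans (rnormD _ _); rewrite addrA subrK. Qed.

Lemma rnorm0 : rnorm (0 : H) = 0.
Proof. by have := normr0 H; rewrite normE => /complexI. Qed.

Lemma rnorm_eq0 f : rnorm f = 0 -> f = 0.
Proof. by move=> f0; apply/eqP; rewrite -normr_eq0 normE f0. Qed.

Lemma rnormZ (a : R[i]) f : (rnorm (a *: f))%:C = `|a| * (rnorm f)%:C.
Proof. by rewrite -!normE normrZ. Qed.

Lemma rnorm_pi_sqr (X : L2fun P) : ((rnorm (\pi_(L2 P) X) ^+ 2)%:E =
  \int[P]_w ((complex.Re (val X w)) ^+ 2)%:E +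
  \int[P]_w ((complex.Im (val X w)) ^+ 2)%:E)%E.
Proof.
have [mr mi fi] : finite_second_moment P (val X).
  by apply/asboolP; have := valP X; rewrite inE.
rewrite rnorm_sqr /reinner inner_pi_norm/= fineK; last first.
  by rewrite ge0_fin_numE//; apply: expectation_ge0 => w; rewrite sqr_ge0.
rewrite unlock; under eq_integral do rewrite normc_sqr EFinD.
rewrite ge0_integralD//.
- by move=> w _; rewrite lee_fin sqr_ge0.
- by apply/measurable_EFinP; exact: measurable_funX.
- by move=> w _; rewrite lee_fin sqr_ge0.
- by apply/measurable_EFinP; exact: measurable_funX.
Qed.

Lemma L2_piB (X Y : L2fun P) : \pi_(L2 P) (X - Y) = \pi_(L2 P) X - \pi_(L2 P) Y.
Proof. by rewrite addrC -scaleN1r L2_pi_linear scaleN1r addrC. Qed.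

Lemma rnorm_piB_sqr (X Y : L2fun P) :
  ((rnorm (\pi_(L2 P) X - \pi_(L2 P) Y) ^+ 2)%:E =
   \int[P]_w ((complex.Re (val X w) - complex.Re (val Y w)) ^+ 2)%:E +
   \int[P]_w ((complex.Im (val X w) - complex.Im (val Y w)) ^+ 2)%:E)%E.
Proof.
rewrite -L2_piB rnorm_pi_sqr.
by congr (_ + _)%E; apply: eq_integral => w _; rewrite L2valD L2valN;
  case: (val X w) (val Y w) => ? ? [? ?].
Qed.

Definition hcauchy (u : nat -> H) := forall e : R, 0 < e ->
  exists N, forall n m, (N <= n)%N -> (N <= m)%N -> rnorm (u n - u m) < e.

Definition hcvg (u : nat -> H) l := forall e : R, 0 < e ->
  exists N, forall n, (N <= n)%N -> rnorm (u n - l) < e.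

Lemma exists_half_pow (e : R) : 0 < e -> exists n, 1 / (2 ^ n.+1)%:R < e.
Proof.
move=> e0; set k := Num.bound e^-1.
have ek : e^-1 < k%:R.
  by apply: le_lt_trans (archi_boundP _); rewrite ?invr_ge0 ?(ltW e0)// ler_norm.
exists k; rewrite div1r invf_plt ?posrE ?ltr0n ?expn_gt0//.
apply: lt_le_trans ek _; rewrite ler_nat.
by clear; elim: k => // k IH; rewrite (leq_ltn_trans IH)// ltn_exp2l.
Qed.

(** A rapidly converging subsequence is split into real and imaginary parts, each dominated by the
    full norm, and the real case is applied to both. *)
Lemma L2_complete (u : nat -> H) : hcauchy u -> exists l, hcvg u l.
Proof.
move=> cu.
have e0 n : 0 < 1 / (2 ^ n.+1)%:R :> R by rewrite divr_gt0// ltr0n expn_gt0.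
have [phi0 phi0P] := choice (fun n => cu _ (e0 n)).
(* Summing the thresholds makes them monotone while keeping [phi n] above [phi0 n]. *)
pose phi n := (\sum_(k < n.+1) phi0 k)%N.
have phi_ge n : (phi0 n <= phi n)%N by rewrite /phi big_ord_recr leq_addl.
have phi_mon n m : (n <= m)%N -> (phi n <= phi m)%N.
  elim: m => [|m IH]; first by rewrite leqn0 => /eqP ->.
  rewrite leq_eqVlt => /predU1P[-> //|/IH /leq_trans]; apply.
  by rewrite {2}/phi big_ord_recr leq_addr.
have phiP n m : (phi n <= m)%N -> rnorm (u (phi n) - u m) <= 1 / (2 ^ n.+1)%:R.
  by move=> nm; apply/ltW/phi0P => //; exact: leq_trans nm.
pose X n := repr (u (phi n)).
have XE n : u (phi n) = \pi_(L2 P) (X n) by rewrite reprK.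
have Xsqr n m : (n <= m)%N ->
    (\int[P]_w ((complex.Re (val (X m) w) - complex.Re (val (X n) w)) ^+ 2)%:E +
    \int[P]_w ((complex.Im (val (X m) w) - complex.Im (val (X n) w)) ^+ 2)%:E <=
    ((1 / (2 ^ n.+1)%:R) ^+ 2)%:E)%E.
  move=> nm; rewrite -rnorm_piB_sqr -!XE lee_fin.
  rewrite ler_sqr ?nnegrE ?rnorm_ge0 ?(ltW (e0 _))//.
  by rewrite rnormBC; apply: phiP; exact: phi_mon.
have [g [gL gP]] : exists g : T -> R, g \in Lfun P 2%:E /\
    forall n, (\int[P]_w ((g w - complex.Re (val (X n) w)) ^+ 2)%:E <=
      ((1 / (2 ^ n.+1)%:R) ^+ 2)%:E)%E.
  apply: riesz_fischer_real => [n|n m nm]; first exact: ReL2.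
  by apply: le_trans (Xsqr n m nm); rewrite leeDl//;
    apply: integral_ge0 => w _; rewrite lee_fin sqr_ge0.
have [h [hL hP]] : exists g : T -> R, g \in Lfun P 2%:E /\
    forall n, (\int[P]_w ((g w - complex.Im (val (X n) w)) ^+ 2)%:E <=
      ((1 / (2 ^ n.+1)%:R) ^+ 2)%:E)%E.
  apply: riesz_fischer_real => [n|n m nm]; first exact: ImL2.
  by apply: le_trans (Xsqr n m nm); rewrite leeDr//;
    apply: integral_ge0 => w _; rewrite lee_fin sqr_ge0.
have YL : (fun w => g w +i* h w) \in L2pred P by apply/L2predP.
pose Y : L2fun P := exist (fun X => X \in L2pred P) _ YL.
exists (\pi_(L2 P) Y) => e ep.
have [n ne] := exists_half_pow (divr_gt0 ep (ltr0n R 3)).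
exists (phi n) => m nm.
apply: le_lt_trans (rnormB_trans (u (phi n)) _ _) _.
rewrite rnormBC.
(* With c = 1 / 2^(n+1), the two parts contribute 2 c^2 <= (2c)^2. The distance from [u m] to
   [u (phi n)] adds another c, which explains [e / 3]. *)
have : rnorm (u (phi n) - \pi_(L2 P) Y) <= 2 * (1 / (2 ^ n.+1)%:R).
  have e1 := e0 n.
  rewrite -ler_sqr ?nnegrE ?rnorm_ge0 ?mulr_ge0 ?(ltW e1)//.
  rewrite -lee_fin rnormBC XE rnorm_piB_sqr.
  apply: le_trans (leeD (gP n) (hP n)) _.
  rewrite -EFinD lee_fin; have := sqr_ge0 (1 / (2 ^ n.+1)%:R : R).
  by set c := 1 / _; lra.
by have := phiP _ _ nm; lra.
Qed.

End Completeness.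

(** * Hilbert space geometry *)

Section HilbertGeometry.
Context {d : measure_display} {T : measurableType d} {R : realType}.
Variable P : probability T R.
Local Notation H := (L2 P).
Implicit Types (f g h : H) (A M : set H).
Local Open Scope complex_scope.
#[local] Arguments complex.Re {R} _.
#[local] Arguments complex.Im {R} _.

Definition subspace M := M 0 /\ forall a f g, M f -> M g -> M (a *: f + g).

Definition hclosed M :=
  forall f, (forall e : R, 0 < e -> exists2 g, M g & rnorm (f - g) < e) -> M f.

Definition linear_on M (V : H -> H) :=
  forall a f g, M f -> M g -> V (a *: f + g) = a *: V f + V g.

Definition isometric_on M (V : H -> H) := forall f, M f -> rnorm (V f) = rnorm f.

Lemma subspaceD M f g : subspace M -> M f -> M g -> M (f + g).
Proof. by move=> [_ sM] Mf Mg; rewrite -[f]scale1r; exact: sM. Qed.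

Lemma subspaceZ M a f : subspace M -> M f -> M (a *: f).
Proof. by move=> [M0 sM] Mf; rewrite -[_ *: _]addr0; exact: sM. Qed.

Lemma subspaceN M f : subspace M -> M f -> M (- f).
Proof. by move=> sM Mf; rewrite -scaleN1r; exact: subspaceZ. Qed.

Lemma subspaceB M f g : subspace M -> M f -> M g -> M (f - g).
Proof. by move=> sM Mf Mg; apply: subspaceD => //; exact: subspaceN. Qed.

Section LinearOn.
Variables (M : set H) (V : H -> H).
Hypotheses (sM : subspace M) (lV : linear_on M V).

Lemma linear_onD f g : M f -> M g -> V (f + g) = V f + V g.
Proof. by move=> Mf Mg; have := lV 1 Mf Mg; rewrite !scale1r. Qed.

Lemma linear_on0 : V 0 = 0.
Proof. by apply: (addrI (V 0)); rewrite -linear_onD ?addr0//; exact: sM.1. Qed.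

Lemma linear_onZ a f : M f -> V (a *: f) = a *: V f.
Proof. by move=> Mf; have := lV a Mf sM.1; rewrite linear_on0 !addr0. Qed.

Lemma linear_onN f : M f -> V (- f) = - V f.
Proof. by move=> Mf; rewrite -scaleN1r linear_onZ// scaleN1r. Qed.

Lemma linear_onB f g : M f -> M g -> V (f - g) = V f - V g.
Proof. by move=> Mf Mg; rewrite linear_onD ?linear_onN//; exact: subspaceN. Qed.

End LinearOn.

Lemma reinnerNl f g : reinner (- f) g = - reinner f g.
Proof. by rewrite -scaleN1r /reinner innerZl mulN1r; case: (inner f g). Qed.

Lemma reinnerBl f g h : reinner (f - g) h = reinner f h - reinner g h.
Proof. by rewrite reinnerDl reinnerNl. Qed.

Lemma reinnerBr f g h : reinner h (f - g) = reinner h f - reinner h g.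
Proof. by rewrite !(reinnerC _ h) reinnerBl. Qed.

Lemma reinnerZJ (a : R[i]) f g : reinner (a *: f) g = reinner f (a^* *: g).
Proof.
rewrite /reinner innerZl (innerC (a^* *: g) f) innerZl (innerC f g).
by case: (inner f g) => ? ?; case: a => ? ? /=; ring.
Qed.

Lemma reinner_polar f g :
  reinner f g = (rnorm (f + g) ^+ 2 - rnorm f ^+ 2 - rnorm g ^+ 2) / 2.
Proof. by rewrite !rnorm_sqr !(reinnerDl, reinnerDr) (reinnerC f g); field. Qed.

(** Since Im z = Re (-i z), whatever preserves [reinner] and is complex linear preserves [inner]. *)
Lemma inner_reE f g : inner f g = reinner f g +i* reinner ((0 -i* 1) *: f) g.
Proof.
by rewrite /reinner innerZl; case: (inner f g) => a b /=; congr (_ +i* _); ring.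
Qed.

Lemma isometric_reinner M V : subspace M -> linear_on M V -> isometric_on M V ->
  forall f g, M f -> M g -> reinner (V f) (V g) = reinner f g.
Proof.
move=> sM lV iV f g Mf Mg.
by rewrite !reinner_polar -(linear_onD lV)// !iV//; exact: subspaceD.
Qed.

Lemma isometric_inner M V : subspace M -> linear_on M V -> isometric_on M V ->
  forall f g, M f -> M g -> inner (V f) (V g) = inner f g.
Proof.
move=> sM lV iV f g Mf Mg.
rewrite !inner_reE -(linear_onZ sM lV)// !(isometric_reinner sM lV iV)//.
exact: subspaceZ.
Qed.

Lemma rnorm_pythagoras f g : reinner f g = 0 ->
  rnorm (f + g) ^+ 2 = rnorm f ^+ 2 + rnorm g ^+ 2.
Proof. by rewrite reinner_polar => h; lra. Qed.

(** The projection is the limit of a sequence minimising the distance to [g]. Completeness of [M] is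
    assumed in sequential form because for the range of an isometry it is obtained by pulling
    sequences back. *)
Lemma orthogonal_projection M (g : H) : subspace M ->
  (forall u, (forall n, M (u n)) -> hcauchy u -> exists2 l, M l & hcvg u l) ->
  exists2 p, M p & forall k, M k -> reinner (g - p) k = 0.
Proof.
move=> sM cM.
pose E := [set rnorm (g - m) | m in M].
have E0 : has_inf E.
  split; first by exists (rnorm (g - 0)), 0 => //; exact: sM.1.
  by exists 0 => _ [m _ <-]; exact: rnorm_ge0.
pose D := inf E.
have D0 : 0 <= D by apply: lb_le_inf => [|_ [m _ <-]]; [exact: E0.1|exact: rnorm_ge0].
have DM m : M m -> D <= rnorm (g - m).
  by move=> Mm; apply: ge_inf; [exact: E0.2|exists m].
have e0 n : 0 < 1 / (2 ^ n.+1)%:R :> R by rewrite divr_gt0// ltr0n expn_gt0.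
have /choice[u uP] n : exists m, M m /\ rnorm (g - m) < D + 1 / (2 ^ n.+1)%:R.
  by have [_ [m Mm <-] mD] := inf_adherent (e0 n) E0; exists m.
have e_le n k : (n <= k)%N -> 1 / (2 ^ k.+1)%:R <= 1 / (2 ^ n.+1)%:R :> R.
  by move=> nk; rewrite !div1r lef_pV2 ?posrE ?ltr0n ?expn_gt0// ler_nat leq_exp2l.
have e_half n : 1 / (2 ^ n.+1)%:R <= 1 / 2 :> R by exact: (e_le 0%N).
have [|p Mp up] := cM u (fun n => (uP n).1).
  move=> e ep.
  (* With eta = 1 / 2^(N+1), the parallelogram law will bound the squared distance by 4 (D + eta)^2
     - 4 D^2 = (8 D + 4 eta) eta, which is at most (8 D + 4) eta. *)
  have [|N Ne] := @exists_half_pow R (e ^+ 2 / (8 * D + 4)).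
    by rewrite divr_gt0 ?exprn_gt0//; lra.
  exists N => n k Nn Nk.
  rewrite -ltr_sqr ?nnegrE ?rnorm_ge0 ?(ltW ep)//.
  move: Ne; rewrite ltr_pdivlMr; last by lra.
  apply: le_lt_trans.
  have eta0 := e0 N; have eh := e_half N.
  have an : rnorm (g - u n) < D + 1 / (2 ^ N.+1)%:R.
    by apply: lt_le_trans (uP n).2 _; rewrite lerD2l e_le.
  have ak : rnorm (g - u k) < D + 1 / (2 ^ N.+1)%:R.
    by apply: lt_le_trans (uP k).2 _; rewrite lerD2l e_le.
  (* The midpoint lies in [M], so it is no closer to [g] than [D]. *)
  have am : D <= rnorm (g - (2^-1)%:C *: (u n + u k)).
    by apply: DM; apply: subspaceZ => //; apply: subspaceD => //; exact: (uP _).1.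
  have -> : rnorm (u n - u k) ^+ 2 = 2 * rnorm (g - u n) ^+ 2 + 2 * rnorm (g - u k) ^+ 2
     - 4 * rnorm (g - (2^-1)%:C *: (u n + u k)) ^+ 2.
    rewrite !rnorm_sqr.
    rewrite !(reinnerBl, reinnerBr, reinnerZl, reinnerZr, reinnerDl, reinnerDr).
    by rewrite (reinnerC g (u n)) (reinnerC g (u k)) (reinnerC (u k) (u n)); field.
  move: eta0 eh an ak am (rnorm_ge0 (g - u n)) (rnorm_ge0 (g - u k)).
  set eta := 1 / (2 ^ _)%:R; set a := rnorm _; set b := rnorm _; set c := rnorm _.
  move=> eta0 eh an ak am a0 b0.
  have a2 : a ^+ 2 <= (D + eta) ^+ 2 by rewrite ler_sqr ?nnegrE; lra.
  have b2 : b ^+ 2 <= (D + eta) ^+ 2 by rewrite ler_sqr ?nnegrE; lra.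
  have c2 : D ^+ 2 <= c ^+ 2 by rewrite ler_sqr ?nnegrE; lra.
  have eta2 : 0 <= eta * (1 / 2 - eta) by rewrite mulr_ge0; lra.
  have Deta : 0 <= D * eta by rewrite mulr_ge0; lra.
  lra.
exists p => // k Mk.
have pD : rnorm (g - p) <= D.
  apply/ler_addgt0Pr => e ep.
  have e2 : 0 < e / 2 by lra.
  have [N1 N1e] := up _ e2.
  have [N2 N2e] := exists_half_pow e2.
  have := N1e _ (leq_maxl N1 N2).
  have := (uP (maxn N1 N2)).2.
  have := e_le _ _ (leq_maxr N1 N2).
  have := rnormB_trans (u (maxn N1 N2)) g p.
  lra.
apply/eqP/negPn/negP.
set c := reinner _ _ => c0.
have K0 := reinner_ge0 k; set K := reinner k k in K0.
have K1 : 0 < K + 1 by lra.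
(* Moving [p] along [k] would shorten the distance if [c] were nonzero. The best step is c / K; the
   denominator [K + 1] also covers [k = 0]. *)
have : D ^+ 2 <= rnorm ((g - p) - (c / (K + 1))%:C *: k) ^+ 2.
  rewrite ler_sqr ?nnegrE ?rnorm_ge0// -addrA -opprD; apply: DM.
  by apply: subspaceD => //; exact: subspaceZ.
have : rnorm (g - p) ^+ 2 <= D ^+ 2 by rewrite ler_sqr ?nnegrE ?rnorm_ge0.
rewrite !rnorm_sqr.
move: @c c0; move: (g - p) => q c c0.
rewrite !(reinnerBl, reinnerBr, reinnerZl, reinnerZr) -/K (reinnerC q k) -/c => h1 h2.
have : 2 * (c / (K + 1) * c) <= c / (K + 1) * (c / (K + 1) * K) by lra.
have -> : 2 * (c / (K + 1) * c) = c ^+ 2 / (K + 1) ^+ 2 * (2 * (K + 1)).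
  by field; exact: lt0r_neq0.
have -> : c / (K + 1) * (c / (K + 1) * K) = c ^+ 2 / (K + 1) ^+ 2 * K.
  by field; exact: lt0r_neq0.
have c2 : 0 < c ^+ 2 by rewrite lt_neqAle sqr_ge0 eq_sym sqrf_eq0 andbT.
rewrite ler_pM2l; last by rewrite divr_gt0// exprn_gt0.
lra.
Qed.

(** Balls of [H] have radii in [R[i]], but a positive element of [R[i]] has zero imaginary part, so
    real radii suffice. *)
Lemma closure_rnormP A f :
  closure A f <-> forall e : R, 0 < e -> exists2 g, A g & rnorm (f - g) < e.
Proof.
split=> [cA e e0|cA B].
  have : nbhs f (ball f e%:C) by apply: nbhsx_ballx; rewrite ltcR.
  by move=> /cA[g [Ag]]; rewrite -ball_normE /= normE ltcR => ?; exists g.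
move=> /nbhs_ballP[[e e'] /= e0 eB].
move: e0 eB; rewrite ltcE /= => /andP[/eqP -> e0] eB.
have [g Ag fg] := cA _ e0.
exists g; split => //; apply: eB.
by rewrite -ball_normE /= normE ltcR.
Qed.

Lemma curve_continuousP (F : R -> H) : continuous F <->
  forall t (e : R), 0 < e -> \forall s \near t, rnorm (F t - F s) < e.
Proof.
split=> cF t.
  move=> e e0; have := cF t => /cvgrPdist_lt /(_ e%:C); rewrite ltcR => /(_ e0).
  by apply: filterS => s; rewrite normE ltcR.
apply/cvgrPdist_lt => -[e e'] /=; rewrite ltcE /= => /andP[/eqP -> e0].
by apply: filterS (cF t _ e0) => s; rewrite normE ltcR.
Qed.

(** * Linear and closed spans *)

Lemma linear_span_sub A : A `<=` linear_span A.
Proof.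
move=> f Af; exists 1%N, (fun=> 1), (fun=> f); split => //.
by rewrite big_ord1 scale1r.
Qed.

Lemma linear_span_subspace A : subspace (linear_span A).
Proof.
split; first by exists 0%N, (fun=> 0), (fun=> 0); split; [case|rewrite big_ord0].
move=> c _ _ [n [a [f [Af ->]]]] [m [b [g [Ag ->]]]].
pose glue (X : Type) (u : 'I_n -> X) (v : 'I_m -> X) (i : 'I_(n + m)) :=
  match fintype.split i with inl j => u j | inr j => v j end.
exists (n + m)%N, (glue _ (fun i => c * a i) b), (glue _ f g); split.
  by move=> i; rewrite /glue; case: fintype.split.
rewrite big_split_ord /= /glue; congr (_ + _).
  rewrite scaler_sumr; apply: eq_bigr => i _.
  by rewrite (unsplitK (inl i)) scalerA.
by apply: eq_bigr => i _; rewrite (unsplitK (inr i)).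
Qed.

Lemma linear_span_ind A M : subspace M -> A `<=` M -> linear_span A `<=` M.
Proof.
move=> sM AM _ [n [a [f [Af ->]]]].
elim/big_ind: _ => [|x y Mx My|i _]; first exact: sM.1.
  exact: subspaceD.
by apply: subspaceZ => //; exact: AM.
Qed.

Lemma closed_span_sub A : A `<=` closed_span A.
Proof. by move=> f /linear_span_sub; exact: subset_closure. Qed.

(** This is the induction principle by which properties of increments are extended to [Hspace] and
    [Hfuture]. *)
Lemma closed_span_ind A M : subspace M -> hclosed M -> A `<=` M ->
  closed_span A `<=` M.
Proof.
move=> sM clM AM f /closure_rnormP cf; apply: clM => e /cf[g Ag fg].
by exists g => //; exact: linear_span_ind Ag.
Qed.

Lemma closed_span_hclosed A : hclosed (closed_span A).
Proof.
move=> f cf; apply/closure_rnormP => e e0.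
have e2 : 0 < e / 2 by lra.
have [g /closure_rnormP /(_ _ e2)[h Ah gh] fg] := cf _ e2.
by exists h => //; have := rnormB_trans g f h; lra.
Qed.

Lemma rnormZ_ler (a : R[i]) :
  exists2 k : R, 0 < k & forall f, rnorm (a *: f) <= k * rnorm f.
Proof.
(* Adding 1 keeps the constant positive for [a = 0], so that one may divide by it. *)
exists (Normc.normc a + 1) => [|f].
  by rewrite ltr_wpDl//; case: a => ? ? /=; exact: sqrtr_ge0.
have -> : rnorm (a *: f) = Normc.normc a * rnorm f.
  by apply: complexI; rewrite rnormZ rmorphM.
by rewrite ler_wpM2r ?rnorm_ge0// lerDl.
Qed.

Lemma closed_span_subspace A : subspace (closed_span A).
Proof.
split; first by apply: subset_closure; exact: (linear_span_subspace A).1.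
move=> a f g /closure_rnormP cf /closure_rnormP cg; apply/closure_rnormP => e e0.
have [k k0 ak] := rnormZ_ler a.
have e2 : 0 < e / 2 by lra.
have [f' Af' ff'] := cf _ (divr_gt0 e2 k0).
have [g' Ag' gg'] := cg _ e2.
exists (a *: f' + g'); first exact: (linear_span_subspace A).2.
rewrite opprD addrACA -scalerBr.
apply: le_lt_trans (rnormD _ _) _.
move: ff'; rewrite ltr_pdivlMr// mulrC => ff'.
have := ak (f - f'); lra.
Qed.

(** * Sequential limits in [H] *)

Lemma hcvg_unique u l l' : hcvg u l -> hcvg u l' -> l = l' :> H.
Proof.
move=> ul ul'; apply/eqP; rewrite -subr_eq0; apply/eqP/rnorm_eq0/eqP.
rewrite eq_le rnorm_ge0 andbT; apply/ler_addgt0Pr => e e0; rewrite add0r.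
have e2 : 0 < e / 2 by lra.
have [N1 /(_ (maxn N1 _)) h1] := ul _ e2; have [N2 /(_ (maxn _ N2)) h2] := ul' _ e2.
have := rnormB_trans (u (maxn N1 N2)) l l'; rewrite (rnormBC l (u _)).
have := h1 N2 (leq_maxl _ _); have := h2 N1 (leq_maxr _ _); lra.
Qed.

Lemma hcvgZD (a : R[i]) (u v : nat -> H) l m : hcvg u l -> hcvg v m ->
  hcvg (fun n => a *: u n + v n) (a *: l + m).
Proof.
move=> ul vm e e0.
have [k k0 ak] := rnormZ_ler a.
have e2 : 0 < e / 2 by lra.
have [N1 h1] := ul _ (divr_gt0 e2 k0).
have [N2 h2] := vm _ e2.
exists (maxn N1 N2) => n; rewrite geq_max => /andP[/h1 n1 /h2 n2].
rewrite opprD addrACA -scalerBr.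
apply: le_lt_trans (rnormD _ _) _.
move: n1; rewrite ltr_pdivlMr// mulrC => n1.
have := ak (u n - l); lra.
Qed.

Lemma hcvg_cauchy u (l : H) : hcvg u l -> hcauchy u.
Proof.
move=> ul e e0; have e2 : 0 < e / 2 by lra.
have [N h] := ul _ e2; exists N => n m /h n1 /h m1.
by have := rnormB_trans l (u n) (u m); rewrite (rnormBC l); lra.
Qed.

Lemma hclosed_hcvg M u l : hclosed M -> (forall n, M (u n)) -> hcvg u l -> M l.
Proof.
move=> cM Mu ul; apply: cM => e /ul[N /(_ N (leqnn N)) h].
by exists (u N) => //; rewrite rnormBC.
Qed.

Lemma hcvg_isometric u (l : H) (c : R) :
  hcvg u l -> (forall n, rnorm (u n) = c) -> rnorm l = c.
Proof.
move=> ul uc; apply/eqP; rewrite eq_le; apply/andP; split.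
  apply/ler_addgt0Pr => e /ul[N /(_ N (leqnn N))]; rewrite rnormBC.
  have := rnormD (l - u N) (u N); rewrite subrK uc; lra.
apply/ler_addgt0Pr => e /ul[N /(_ N (leqnn N))].
have := rnormD (u N - l) l; rewrite subrK uc; lra.
Qed.

End HilbertGeometry.

(** * Unitary groups and cocycles *)

Section Cocycles.
Context {d : measure_display} {T : measurableType d} {R : realType}.
Variable P : probability T R.
Local Notation H := (L2 P).
Implicit Types (f g h : H) (V : H -> H) (U W : R -> H -> H) (xi : R -> H).

Lemma setT_subspace : subspace [set: H]. Proof. by []. Qed.

Section Unitary.
Variable V : H -> H.
Hypothesis uV : unitary V.

Lemma unitary_linear_on M : linear_on M V.
Proof. by case: uV => lV _ _ a f g _ _; exact: lV. Qed.

Lemma unitaryD f g : V (f + g) = V f + V g.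
Proof. exact: (linear_onD (@unitary_linear_on setT)). Qed.

Lemma unitaryN f : V (- f) = - V f.
Proof. exact: (linear_onN setT_subspace (@unitary_linear_on setT)). Qed.

Lemma unitaryB f g : V (f - g) = V f - V g.
Proof. by rewrite unitaryD unitaryN. Qed.

Lemma unitary_rnorm f : rnorm (V f) = rnorm f.
Proof. by case: uV => _ iV _; rewrite /rnorm /reinner iV. Qed.

End Unitary.

Lemma unitary_comp V V' : unitary V -> unitary V' -> unitary (V \o V').
Proof.
move=> [lV iV sV] [lV' iV' sV']; split.
- by move=> a f g /=; rewrite lV' lV.
- by move=> f g /=; rewrite iV iV'.
- by move=> g; have [f <-] := sV g; have [h <-] := sV' f; exists h.
Qed.

Lemma unitaryI V : linear V -> (forall f, rnorm (V f) = rnorm f) ->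
  (forall g, exists f, V f = g) -> unitary V.
Proof.
move=> lV nV sV; split => // f g.
have lVT : linear_on setT V by move=> a {}f {}g _ _; exact: lV.
have nVT : isometric_on setT V by move=> {}f _; exact: nV.
exact: (isometric_inner setT_subspace lVT nVT).
Qed.

Lemma unitary_groupK U t f : unitary_group U -> U t (U (- t) f) = f.
Proof. by case=> _ U0 UD _; rewrite -UD subrr U0. Qed.

Lemma unitary_group_adjoint U t f : unitary_group U -> adjoint (U t) f = U (- t) f.
Proof.
by move=> gU; have [uU _ _ _] := gU; rewrite -{1}[f](unitary_groupK t f gU) adjointK.
Qed.

Lemma invariance_increment U xi t s r : invariance_groups xi U ->
  U t (xi s - xi r) = xi (t + s) - xi (t + r).
Proof.
move=> [[uU _ _ _] xiU]; rewrite (unitaryB (uU t)) !xiU.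
by rewrite opprD addrACA subrr add0r.
Qed.

Lemma Hspace_subspace xi : subspace (Hspace xi).
Proof. exact: closed_span_subspace. Qed.

Lemma Hspace_increment xi s r : Hspace xi (xi s - xi r).
Proof. by apply: closed_span_sub; exists s, r. Qed.

Lemma Hspace_curve xi t : xi 0 = 0 -> Hspace xi (xi t).
Proof. by move=> xi0; have := @Hspace_increment xi t 0; rewrite xi0 subr0. Qed.

Lemma Hfuture_increment xi t s r : t <= s -> t <= r -> Hfuture xi t (xi s - xi r).
Proof. by move=> ts tr; apply: closed_span_sub; exists s, r. Qed.

(** If [g] is fixed, then V f - f = V (f - g) + (g - f) has norm at most twice that of f - g, so the
    fixed vectors form a closed set. Membership in [M] is carried along because [V] is controlled
    only there. *)
Lemma fixed_closed_span A M V : A `<=` M -> subspace M -> hclosed M ->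
  linear_on M V -> isometric_on M V -> (forall f, A f -> V f = f) ->
  forall f, closed_span A f -> M f /\ V f = f.
Proof.
move=> AM sM cM lV iV fA; apply: (closed_span_ind (M := [set f | M f /\ V f = f])).
- split => [|a f g [Mf Vf] [Mg Vg]].
    by split; [exact: sM.1|exact: linear_on0 lV].
  by split; [exact: sM.2|rewrite lV// Vf Vg].
- move=> f cf; have Mf : M f.
    by apply: cM => e /cf[g [Mg _] fg]; exists g.
  split => //; apply/eqP; rewrite -subr_eq0; apply/eqP/rnorm_eq0/eqP.
  rewrite eq_le rnorm_ge0 andbT; apply/ler_addgt0Pr => e e0; rewrite add0r.
  have [g [Mg Vg] fg] := cf _ (divr_gt0 e0 (ltr0n R 2)).
  have := rnormB_trans g (V f) f.
  rewrite -{1}Vg -(linear_onB sM lV)// iV; last exact: subspaceB sM _ _.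
  by rewrite (rnormBC g); lra.
- by move=> f Af; split; [exact: AM|exact: fA].
Qed.

Lemma Hspace_group U xi t f : invariance_groups xi U -> Hspace xi f -> Hspace xi (U t f).
Proof.
move=> iU; have [[uU _ _ _] _] := iU.
apply: (closed_span_ind (M := [set f | Hspace xi (U t f)])).
- split => [|a {}f g /= Uf Ug].
    rewrite /= (linear_on0 setT_subspace (@unitary_linear_on _ (uU t) _)).
    exact: (Hspace_subspace xi).1.
  by rewrite (unitary_linear_on (uU t) (M := setT))//; exact: (Hspace_subspace xi).2.
- move=> {}f cf; apply: closed_span_hclosed => e /cf[g Ug fg].
  by exists (U t g) => //; rewrite -(unitaryB (uU t)) (unitary_rnorm (uU t)).
- move=> _ [s [r [_ _ ->]]] /=; rewrite (invariance_increment _ _ _ iU).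
  exact: Hspace_increment.
Qed.

(** * From the isometry to the cocycle *)

Lemma isometry_invariance_group xi xi' U V : xi 0 = 0 -> invariance_groups xi U ->
  linear_on (Hspace xi) V -> isometric_on (Hspace xi) V ->
  (forall t, xi' t = V (xi t)) -> exists U', invariance_groups xi' U'.
Proof.
move=> xi0 iU lV nV xiV.
have [[uU U0 UD cU] xiU] := iU.
have sM := Hspace_subspace xi; set M := Hspace xi in lV nV sM.
have MU t f : M f -> M (U t f) by exact: Hspace_group.
have V0 := linear_on0 sM lV.
have sVM : subspace (V @` M).
  split; first by exists 0 => //; exact: sM.1.
  by move=> a _ _ [f Mf <-] [g Mg <-]; exists (a *: f + g); [exact: sM.2|rewrite lV].
(* A Cauchy sequence of the range pulls back isometrically to one in the closed subspace [M], and
   its limit there is mapped forward again. *)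
have cVM u : (forall n, (V @` M) (u n)) -> hcauchy u -> exists2 l, (V @` M) l & hcvg u l.
  move=> Vu cu.
  have /choice[v vP] n : exists f, M f /\ V f = u n by have [f] := Vu n; exists f.
  have uvB n l : M l -> rnorm (u n - V l) = rnorm (v n - l).
    move=> Ml; have [Mv <-] := vP n.
    by rewrite -(linear_onB sM lV)// nV//; exact: subspaceB sM _ _.
  have [|l vl] := @L2_complete _ _ _ P v.
    move=> e /cu[N h]; exists N => n m Nn Nm.
    by rewrite -uvB ?(vP _).2 ?h//; exact: (vP m).1.
  have Ml : M l.
    exact: (hclosed_hcvg (@closed_span_hclosed _ _ _ _ _) (fun n => (vP n).1) vl).
  exists (V l); first by exists l.
  by move=> e /vl[N h]; exists N => n Nn; rewrite uvB ?h.
(* V (S g) is the orthogonal projection of g on the range of V, so that U'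
   below is the transport of U by V on that range and trivial on its
   orthogonal complement. *)
have /choice[S SP] g : exists h, M h /\ forall k, M k -> reinner (g - V h) (V k) = 0.
  have [_ [h Mh <-] hP] := orthogonal_projection g sVM cVM.
  by exists h; split => // k Mk; apply: hP; exists k.
(* Two candidates differ by a vector of the range orthogonal to the range. This uniqueness gives
   linearity of [S] and its value on sums of a range vector and an orthogonal one. *)
have SE g h : M h -> (forall k, M k -> reinner (g - V h) (V k) = 0) -> S g = h.
  move=> Mh hP; have [MSg SgP] := SP g.
  have Mk : M (S g - h) by exact: subspaceB sM _ _.
  apply/eqP; rewrite -subr_eq0; apply/eqP/rnorm_eq0; rewrite -nV//.
  apply/eqP; rewrite -sqrf_eq0 rnorm_sqr; apply/eqP.
  rewrite {1}(linear_onB sM lV)//.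
  have -> : V (S g) - V h = (g - V h) - (g - V (S g)).
    by rewrite opprB [RHS]addrC addrA subrK.
  by rewrite reinnerBl hP// SgP// subrr.
have S_V h w : M h -> (forall k, M k -> reinner w (V k) = 0) -> S (V h + w) = h.
  by move=> Mh wP; apply: SE => // k Mk; rewrite addrC addKr wP.
have SV h : M h -> S (V h) = h.
  move=> Mh; rewrite -[V h]addr0; apply: S_V => // k Mk.
  by rewrite -[0](subrr (V k)) reinnerBl subrr.
have lS a f g : S (a *: f + g) = a *: S f + S g.
  have [MSf fP] := SP f; have [MSg gP] := SP g.
  apply: SE => [|k Mk]; first exact: sM.2.
  rewrite lV// opprD addrACA -scalerBr reinnerDl gP// addr0 reinnerZJ.
  by rewrite -(linear_onZ sM lV)// fP//; exact: subspaceZ sM _.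
pose U' t g := V (U t (S g)) + (g - V (S g)).
(* [S] intertwines [U'] with [U], and [U'] leaves the orthogonal component alone; the group law of
   [U] therefore passes to [U']. *)
have U'S t g : S (U' t g) = U t (S g).
  by apply: S_V; [apply: MU; exact: (SP g).1|exact: (SP g).2].
have U'D t s g : U' (t + s) g = U' t (U' s g).
  transitivity (V (U t (S (U' s g))) + (U' s g - V (S (U' s g)))); last by [].
  rewrite U'S /U' UD.
  by rewrite [V (U s _) + _]addrC addrK.
have U'0 g : U' 0 g = g by rewrite /U' U0 addrC subrK.
have U'l t : linear (U' t).
  move=> a f g; rewrite /U' lS; have [Mf _] := SP f; have [Mg _] := SP g.
  rewrite (unitary_linear_on (uU t) (M := setT))// !lV//; [|exact: MU..].
  by rewrite opprD [X in _ + X]addrACA -scalerBr addrACA -scalerDr.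
(* Pythagoras is used before and after: the orthogonal component is the same, and the range
   components have equal norms. *)
have U'n t g : rnorm (U' t g) = rnorm g.
  have [Mg gP] := SP g.
  apply/eqP; rewrite -(@eqrXn2 _ 2) ?rnorm_ge0//; apply/eqP.
  rewrite rnorm_pythagoras; last by rewrite reinnerC gP//; exact: MU.
  rewrite nV ?(unitary_rnorm (uU t)); last exact: MU.
  rewrite -(nV _ Mg) -rnorm_pythagoras; first by rewrite [_ + (g - _)]addrC subrK.
  by rewrite reinnerC gP.
exists U'; split; first split => //.
- move=> t; apply: unitaryI => // g; exists (U' (- t) g).
  by rewrite -U'D subrr U'0.
(* The orthogonal component cancels in differences, leaving the strong continuity of [U] at
   [S f]. *)
- move=> f; apply/curve_continuousP => t e e0.
  have /curve_continuousP /(_ t e e0) := cU (S f).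
  apply: filterS => s; rewrite /U' opprD addrACA subrr addr0.
  have [Mf _] := SP f.
  by rewrite -(linear_onB sM lV) ?nV//; [|exact: MU..]; apply: (subspaceB sM); exact: MU.
- move=> t s; rewrite !xiV /U' SV; last exact: Hspace_curve.
  by rewrite subrr addr0 xiU (linear_onD lV)//; [|apply: MU]; exact: Hspace_curve.
Qed.

Lemma unitary_groups_cocycle U U' xi : unitary_group U -> unitary_group U' ->
  (forall t f, 0 < t -> Hfuture xi t f -> U' t (U (- t) f) = f) ->
  markovian_cocycle U xi (fun t f => U' t (U (- t) f)).
Proof.
move=> gU gU' fix_future.
have [uU U0 UD cU] := gU; have [uU' U'0 U'D cU'] := gU'.
split => //.
- split=> [t|f]; first exact: (unitary_comp (uU' t) (uU (- t))).
  apply/curve_continuousP => t e e0.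
  have e2 : 0 < e / 2 by lra.
  have /curve_continuousP /(_ t _ e2) h' := cU' (U (- t) f).
  have /curve_continuousP /(_ (- t) _ e2) h := cU f.
  have {}h : \forall s \near t, rnorm (U (- t) f - U (- s) f) < e / 2.
    have /(_ _ h) : (- s : R) @[s --> t] --> - t by apply: cvgN; exact: cvg_id.
    by [].
  apply: filterS2 h h' => s h h'.
  (* Only one factor changes at a time; the change in [U] passes through [U' s] with its norm
     preserved. *)
  have := rnormB_trans (U' s (U (- t) f)) (U' t (U (- t) f)) (U' s (U (- s) f)).
  by rewrite -(unitaryB (uU' s)) (unitary_rnorm (uU' s)); lra.
- by move=> f; rewrite oppr0 U0 U'0.
- move=> t s f; rewrite unitary_group_adjoint// -[U (- t) (U t _)]UD addNr U0.
  by rewrite U'D opprD addrC UD.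
Qed.

Lemma cocycle_of_isometry xi1 xi2 U1 V : xi1 0 = 0 -> invariance_groups xi1 U1 ->
  markovian_isometrical_operator xi1 xi2 V -> (forall t, xi2 t = V (xi1 t)) ->
  exists W, [/\ markovian_cocycle U1 xi1 W,
    forall t : R, t <= 0 -> xi2 t = W t (xi1 t) &
    forall t : R, 0 < t -> xi2 t = xi1 t].
Proof.
move=> xi10 iU1 [[_ lV nV] Vfut] xiV.
have {}nV : isometric_on (Hspace xi1) V by move=> f /nV/rnorm_inj.
have [U2 iU2] := isometry_invariance_group xi10 iU1 lV nV xiV.
have [gU1 xiU1] := iU1; have [gU2 xiU2] := iU2.
have [uU1 _ _ _] := gU1; have [uU2 _ _ _] := gU2.
have xi_pos t : 0 <= t -> xi2 t = xi1 t.
  move=> t0; rewrite xiV Vfut// -[xi1 t]subr0 -xi10.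
  exact: Hfuture_increment.
have xi20 : xi2 0 = 0 by rewrite xi_pos.
exists (fun t f => U2 t (U1 (- t) f)); split.
- apply: unitary_groups_cocycle => // t f t0 ft.
  suff [] : [set: H] f /\ (U2 t \o U1 (- t)) f = f by [].
  have uW := unitary_comp (uU2 t) (uU1 (- t)).
  apply: fixed_closed_span ft => //.
  + exact: unitary_linear_on.
  + by move=> g _; exact: unitary_rnorm uW g.
  (* Shifted by [- t], the times [s] and [r] are still nonnegative, so the increment can be
     rewritten in terms of [xi2] before [U2 t] acts. *)
  + move=> _ [s [r [/= ts tr ->]]].
    rewrite (invariance_increment _ _ _ iU1).
    rewrite -!xi_pos; [|lra..].
    rewrite (invariance_increment _ _ _ iU2) !addNKr.
    by rewrite ?addrA ?subrr ?add0r.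
(* Here [U1 (- t)] sends [xi1 t] to [xi1 0 - xi1 (- t)], an increment over nonnegative times shared
   with [xi2]; [U2 t] sends it to [xi2 t]. *)
- move=> t t0.
  have -> : xi1 t = xi1 t - xi1 0 by rewrite xi10 subr0.
  rewrite (invariance_increment _ _ _ iU1) -!xi_pos; [|lra..].
  rewrite (invariance_increment _ _ _ iU2) addr0 subrr xi20.
  by rewrite subr0 addNr addr0.
- by move=> t t0; apply: xi_pos; exact: ltW.
Qed.

(** * From the cocycle to the isometry *)

Lemma cocycle_curve xi1 xi2 U1 W t s : xi1 0 = 0 -> invariance_groups xi1 U1 ->
  markovian_cocycle U1 xi1 W ->
  (forall t : R, t <= 0 -> xi2 t = W t (xi1 t)) ->
  (forall t : R, 0 < t -> xi2 t = xi1 t) ->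
  t < 0 -> t <= s -> W t (xi1 s) = xi2 s.
Proof.
move=> xi10 iU1 [_ W0 WD Wfut] xi_neg xi_pos t0 ts.
have [gU1 _] := iU1.
have incE r : U1 (- t) (xi1 r) = xi1 (r - t) - xi1 (- t).
  rewrite -{1}[xi1 r]subr0 -xi10 (invariance_increment _ _ _ iU1) addr0.
  by rewrite [- t + r]addrC.
(* [W m] already sends [xi1 s] to [xi2 s], by the formula for nonpositive times or by [W 0 = I]. The
   cocycle identity for [m = t + (m - t)] will show that [W t] does the same. *)
pose m := Num.min s 0.
have [ms m0] : m <= s /\ m <= 0 by rewrite !ge_min !lexx orbT.
have xi2E : xi2 s = W m (xi1 s).
  rewrite /m; case: (leP s 0) => s0; first exact: xi_neg.
  by rewrite W0 xi_pos.
(* The Markov property is available only at the strictly positive time [m - t]. *)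
have [mt|mt] := eqVneq m t; first by rewrite xi2E mt.
have mt0 : 0 < m - t by rewrite subr_gt0 lt_neqAle eq_sym mt le_min ts ltW.
(* Both endpoints are late enough because [m <= s] and [m <= 0]; hence [W (m - t)] fixes the image
   of [xi1 s] under [U1 (- t)]. *)
have fut : Hfuture xi1 (m - t) (xi1 (s - t) - xi1 (- t)).
  by apply: Hfuture_increment; lra.
rewrite xi2E -[in RHS](subrKC t m) WD unitary_group_adjoint// incE (Wfut _ _ mt0 fut).
by rewrite -incE unitary_groupK.
Qed.

Lemma isometry_of_cocycle xi1 xi2 U1 W : xi1 0 = 0 -> xi2 0 = 0 ->
  invariance_groups xi1 U1 -> markovian_cocycle U1 xi1 W ->
  (forall t : R, t <= 0 -> xi2 t = W t (xi1 t)) ->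
  (forall t : R, 0 < t -> xi2 t = xi1 t) ->
  exists V, markovian_isometrical_operator xi1 xi2 V /\
      forall t : R, xi2 t = V (xi1 t).
Proof.
move=> xi10 xi20 iU1 cW xi_neg xi_pos.
have [[uW _] _ _ _] := cW.
have sM := Hspace_subspace xi1.
(* The successor keeps the time strictly negative, as [cocycle_curve] demands. *)
pose W_ f n := W (- n.+1%:R) f.
have W_inc s r : hcvg (W_ (xi1 s - xi1 r)) (xi2 s - xi2 r).
  (* Beyond this index the time [- n.+1] lies below both [s] and [r], and the sequence equals its
     limit. *)
  move=> e e0; exists (Num.bound (`|s| + `|r|)) => n Nn.
  rewrite /W_ (unitaryB (uW _)).
  have nlt : `|s| + `|r| < n.+1%:R.
    apply: lt_le_trans (archi_boundP _) _; first by rewrite addr_ge0.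
    by rewrite ler_nat ltnW.
  have := ler_norm (- s); have := ler_norm (- r); rewrite !normrN.
  have := normr_ge0 s; have := normr_ge0 r => r0 s0 rn sn.
  have n0 : - n.+1%:R < 0 :> R by rewrite oppr_lt0 ltr0n.
  by rewrite !(cocycle_curve xi10 iU1 cW xi_neg xi_pos n0) ?subrr ?rnorm0//; lra.
have cvgW f : Hspace xi1 f -> exists l, hcvg (W_ f) l.
  move=> Mf; apply: L2_complete; move: f Mf.
  apply: (closed_span_ind (M := [set f | hcauchy (W_ f)])).
  - split => [e e0|a f g /L2_complete[l fl] /L2_complete[m gm]].
      exists 0%N => n m _ _; rewrite /W_.
      by rewrite !(linear_on0 setT_subspace (@unitary_linear_on _ (uW _) _)) subrr rnorm0.
    have := hcvg_cauchy (hcvgZD a fl gm); congr hcauchy; apply/funext => n.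
    by rewrite /W_ (unitary_linear_on (uW _) (M := setT)).
  (* Because each [W] preserves norms, the error of replacing [f] by a nearby [g] is the same for
     every index. *)
  - move=> f cf e e0; have e3 : 0 < e / 3 by lra.
    have [g cg fg] := cf _ e3; have [N h] := cg _ e3.
    exists N => n m Nn Nm; have gnm := h n m Nn Nm.
    have fgn k : rnorm (W_ f k - W_ g k) < e / 3.
      by rewrite /W_ -(unitaryB (uW _)) (unitary_rnorm (uW _)).
    have := fgn n; have := fgn m; rewrite [X in X < _ -> _]rnormBC.
    have := rnormB_trans (W_ g n) (W_ f n) (W_ f m).
    have := rnormB_trans (W_ g m) (W_ g n) (W_ f m).
    lra.
  - by move=> _ [s [r [_ _ ->]]]; exact: hcvg_cauchy (W_inc s r).
pose V f := xget 0 [set l | hcvg (W_ f) l].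
have VE f l : hcvg (W_ f) l -> V f = l.
  by move=> fl; rewrite /V; case: xgetP => [l' _ fl'|/(_ l)//]; exact: hcvg_unique fl.
have VP f : Hspace xi1 f -> hcvg (W_ f) (V f).
  by move=> /cvgW[l fl]; rewrite (VE _ _ fl).
have lV : linear_on (Hspace xi1) V.
  move=> a f g Mf Mg; apply: VE.
  have -> : W_ (a *: f + g) = fun n => a *: W_ f n + W_ g n.
    by apply/funext => n; rewrite /W_ (unitary_linear_on (uW _) (M := setT)).
  by apply: hcvgZD; exact: VP.
have nV : isometric_on (Hspace xi1) V.
  move=> f /VP fV; apply: (hcvg_isometric fV) => n.
  exact: (unitary_rnorm (uW _)).
have V_inc s r : V (xi1 s - xi1 r) = xi2 s - xi2 r by exact: VE.
exists V; split; last first.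
  by move=> t; have := V_inc t 0; rewrite xi10 xi20 !subr0.
split; first split => //.
(* The induction also records membership in [Hspace xi1], without which [V] is not known to be
   linear or isometric. *)
- move=> f Mf; suff [] : Hspace xi1 f /\ Hspace xi2 (V f) by [].
  move: f Mf; apply: (closed_span_ind (M := [set f | Hspace xi1 f /\ Hspace xi2 (V f)])).
  + split=> [|a f g [Mf Vf] [Mg Vg]].
      split; first exact: sM.1.
      by rewrite (linear_on0 sM lV); exact: (Hspace_subspace xi2).1.
    by split; [exact: sM.2|rewrite lV//; exact: (Hspace_subspace xi2).2].
  + move=> f cf; have Mf : Hspace xi1 f.
      by apply: closed_span_hclosed => e /cf[g [Mg _] fg]; exists g.
    split => //; apply: closed_span_hclosed => e /cf[g [Mg Vg] fg].
    by exists (V g) => //; rewrite -(linear_onB sM lV)// nV//; exact: subspaceB sM _ _.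
  + move=> _ [s [r [_ _ ->]]]; split; first exact: Hspace_increment.
    by rewrite V_inc; exact: Hspace_increment.
- by move=> f /nV Vf; rewrite !normE Vf.
- move=> f ff; suff [] : Hspace xi1 f /\ V f = f by [].
  apply: fixed_closed_span ff => //.
  + by move=> _ [s [r [_ _ ->]]]; exact: Hspace_increment.
  + exact: closed_span_hclosed.
  + have xi_ge0 t : 0 <= t -> xi2 t = xi1 t.
      by rewrite le_eqVlt => /predU1P[<-|/xi_pos//]; rewrite xi10.
    by move=> _ [s [r [/= s0 r0 ->]]]; rewrite V_inc !xi_ge0.
Qed.

End Cocycles.

Theorem proposition1p3 (d : measure_display) (T : measurableType d)
    (R : realType) (P : probability T R) (xi1 xi2 : R -> L2 P)
    (U1 : R -> L2 P -> L2 P) :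
  stationary_process xi1 -> stationary_process xi2 ->
  invariance_groups xi1 U1 ->
  (exists V : L2 P -> L2 P,
      markovian_isometrical_operator xi1 xi2 V /\
      forall t : R, xi2 t = V (xi1 t)) <->
  (exists W : R -> L2 P -> L2 P,
      [/\ markovian_cocycle U1 xi1 W,
          forall t : R, t <= 0 -> xi2 t = W t (xi1 t) &
          forall t : R, 0 < t -> xi2 t = xi1 t]).
Proof.
move=> [_ xi10 _] [_ xi20 _] iU1; split=> [[V [mV xiV]]|[W [mW xi_neg xi_pos]]].
  exact: cocycle_of_isometry mV xiV.
exact: isometry_of_cocycle mW xi_neg xi_pos.
Qed.
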